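(* Let $p,q\ge 0$ be integers with $p\leq q+1$, let $a_1,\dots,a_p,c_1,\dots,c_q,\gamma,\alpha,\beta$ be complex numbers with $1-c_j\notin\mathbb{N}=\{1,2,3,\dots\}$ for all $j$, $\alpha\neq-1$, $\beta\neq0$ and $-\frac{\alpha+1}{\beta}\notin\mathbb{N}$. Then $$\int x^\alpha\;{}_pF_q\left(\begin{array}{c}a_1\ \dots\ a_p\\ c_1\ \dots\ c_q\end{array};\gamma x^\beta\right)dx=\frac{x^{\alpha+1}}{\alpha+1}\;{}_{p+1}F_{q+1}\left(\begin{array}{c}a_1\ \dots\ a_p\quad \frac{\alpha+1}{\beta}\\ c_1\ \dots\ c_q\quad 1+\frac{\alpha+1}{\beta}\end{array};\gamma x^\beta\right)+c,$$ where $c$ is an arbitrary constant.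
   Context: The Pochhammer symbol is $(a)_k=a(a+1)\cdots(a+k-1)$, $(a)_0=1$. For $p\le q+1$ and $1-c_j\notin\mathbb{N}$ for all $j$, the generalized hypergeometric function is defined by the series $${}_pF_q\left(\begin{array}{c}a_1\ \dots\ a_p\\ c_1\ \dots\ c_q\end{array};x\right)=\sum_{k=0}^\infty\frac{(a_1)_k\cdots(a_p)_k}{(c_1)_k\cdots(c_q)_k}\frac{x^k}{k!},$$ which converges for all $x$ if $p\le q$ and for $|x|<1$ if $p=q+1$. An identity $\int g(x)\,dx=G(x)+c$ means that $G'(x)=g(x)$. Here $x$ ranges over any open connected set $U\subset\mathbb{C}\setminus\{0\}$ (or open interval of $(0,\infty)$) on which a branch of $\log x$ is fixed, powers are $x^s=\exp(s\log x)$ with this branch, and, if $p=q+1$, $|\gamma x^\beta|<1$ on $U$. *)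

(* Defs.v *)
From Stdlib Require Export Reals Arith Factorial List.
From Coquelicot Require Export Coquelicot.
Export ListNotations.

Definition Cexp (z : C) : C :=
  (exp (Re z) * cos (Im z), exp (Re z) * sin (Im z))%R.

(* The power [x^s] for the determination [l] of [log x]. *)
Definition cpow (l s : C) : C := Cexp (s * l)%C.

(* [L] is a continuous branch of the logarithm on [D].  The map [i] embeds the
   domain into [C]: the identity for [D] in [C], [RtoC] for [D] in [R]. *)
Definition log_branch {T : UniformSpace} (i : T -> C) (D : T -> Prop)
    (L : T -> C) : Prop :=
  forall x : T, D x ->
    continuous (U := C_UniformSpace) L x /\ Cexp (L x) = i x.

Definition connected_subset {T : UniformSpace} (D : T -> Prop) : Prop :=
  forall A B : T -> Prop,
    open A -> open B ->
    (forall x, D x -> A x \/ B x) ->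
    (exists x, D x /\ A x) ->
    (exists x, D x /\ B x) ->
    exists x, D x /\ A x /\ B x.

Definition positive_integer (z : C) : Prop :=
  exists n : nat, (1 <= n)%nat /\ z = RtoC (INR n).

Fixpoint pochhammer (a : C) (k : nat) : C :=
  match k with
  | O => RtoC 1
  | S j => (pochhammer a j * (a + RtoC (INR j)))%C
  end.

Definition Cprod (s : list C) : C := fold_right Cmult (RtoC 1) s.

(* Coquelicot's [Series] is real-valued; summing the two components gives the
   sum of a complex series whenever it converges (next lemma). *)
Definition CSeries (u : nat -> C) : C :=
  (Series (fun k => Re (u k)), Series (fun k => Im (u k))).

Lemma CSeries_unique (u : nat -> C) (l : C) :
  is_series (V := C_NormedModule) u l -> CSeries u = l.
Proof.
intros H.
assert (Hs : forall n, sum_n (G := C_AbelianMonoid) u n =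
   (sum_n (fun k => Re (u k)) n, sum_n (fun k => Im (u k)) n)).
{ induction n as [|n IH].
  - rewrite !sum_O; now destruct (u 0%nat).
  - rewrite !sum_Sn, IH; reflexivity. }
assert (Hl : filterlim (sum_n (G := C_AbelianMonoid) u) eventually
               (locally (T := C_UniformSpace) l)) by exact H.
unfold CSeries; rewrite (surjective_pairing l); f_equal;
  apply is_series_unique; intros P [e He].
- destruct (Hl (fun z => P (fst z))) as [N HN].
  + exists e; intros z [Hz _]; now apply He.
  + exists N; intros n Hn; generalize (HN n Hn); now rewrite Hs.
- destruct (Hl (fun z => P (snd z))) as [N HN].
  + exists e; intros z [_ Hz]; now apply He.
  + exists N; intros n Hn; generalize (HN n Hn); now rewrite Hs.
Qed.

(* The lists carry the upper and lower parameters, so [p = length a] and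
   [q = length c]. *)
Definition pFq (a c : list C) (x : C) : C :=
  CSeries (fun k =>
    Cprod (map (fun ai => pochhammer ai k) a)
    / Cprod (map (fun cj => pochhammer cj k) c)
    * (x ^ k / RtoC (INR (fact k))))%C.

(* [G' = g] on [D]: the complex derivative for [K = C_AbsRing], the derivative
   of a function of a real variable for [K = R_AbsRing]. *)
Definition antiderivative {K : AbsRing} {V : NormedModule K}
    (D : K -> Prop) (g G : K -> V) : Prop :=
  forall x : K, D x -> is_derive G x (g x).

(* Main.v *)
Require Import Defs.
From Stdlib Require Import Lra Lia.

(** Write [s = (alpha + 1) / beta] and let [u k], [v k] be the Taylor
    coefficients of the hypergeometric function in the integrand and of the
    one with the additional parameters [s] and [1 + s].  Since
    [(s)_k / (1 + s)_k = s / (s + k)], the coefficients satisfy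
    [(s + k) v k = s u k]; summed against [w ^ k] this is the Euler equation
    [s F + w F' = s f] between the two functions [F] and [f]
    ([pFq_raise_euler]).  With [w = gamma x^beta] one has [x w' = beta w] and
    [s beta = alpha + 1], so the derivative of [x^(alpha+1) / (alpha+1) F(w)]
    is [x^alpha (F(w) + w F'(w) / s) = x^alpha f(w)].

    The analysis behind this computation has three ingredients.  A complex
    power series may be differentiated term by term inside its disk of
    convergence ([is_Cderive_CPSeries]), and the ratio test shows that the
    disk is large enough ([in_Cdisk_hyp_coef]).  The exponential is its own
    complex derivative ([is_Cderive_Cexp]).

    Finally, both parts of the theorem come from one computation, made in the
    variable [l = log x] ([is_Cderive_primitive_log]): all the powers are
    entire functions of [l].  The return to [x] uses no derivative of the
    branch [L].  Where [E' <> 0], the increments of a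
    function [H] are those of [E] times [H' / E'], up to a negligible error
    ([Cderive_relative]); for [E = Cexp], continuity of [L] and
    [Cexp (L x) = x] turn this into a statement about increments of [x],
    whether [x] is complex or real ([log_branch_increment]). *)

(** * Complex derivatives *)

Notation is_Cderive := (is_derive (K := C_AbsRing) (V := C_NormedModule)).

Lemma is_Cderive_eps (f : C -> C) (z l : C) :
  is_Cderive f z l <->
  forall eps : posreal, exists delta : posreal, forall y : C,
    (Cmod (y - z) < delta ->
     Cmod (f y - f z - (y - z) * l) <= eps * Cmod (y - z))%R.
Proof.
split.
- intros [_ Hd] eps.
  destruct (Hd z (fun P HP => HP) eps) as [delta Hdelta].
  exists delta; intros y Hy; exact (Hdelta y Hy).
- intros H; split.
  + exact (is_linear_scal_l (K := C_AbsRing) (V := C_NormedModule) l).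
  + intros x Hx eps.
    rewrite <- (is_filter_lim_locally_unique (V := AbsRing_NormedModule C_AbsRing) _ _ Hx).
    destruct (H eps) as [delta Hdelta].
    exists delta; intros y Hy; exact (Hdelta y Hy).
Qed.

Lemma is_Cderive_const (k z : C) : is_Cderive (fun _ => k) z (RtoC 0).
Proof.
exact (is_derive_const (K := C_AbsRing) (V := C_NormedModule) k z).
Qed.

Lemma is_Cderive_plus (f g : C -> C) (z df dg : C) :
  is_Cderive f z df -> is_Cderive g z dg ->
  is_Cderive (fun y => f y + g y)%C z (df + dg)%C.
Proof.
exact (is_derive_plus (K := C_AbsRing) (V := C_NormedModule) f g z df dg).
Qed.

(** [C] carries two normed module structures over itself, with the same norm
    but different uniform structures.  The product and chain rules concern
    functions into the second one. *)
Lemma is_Cderive_AbsRing (f : C -> C) (z l : C) :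
  is_Cderive f z l <->
  is_derive (K := C_AbsRing) (V := AbsRing_NormedModule C_AbsRing) f z l.
Proof.
split; intros [[H1 H2 H3] Hd]; (split; [split; [exact H1|exact H2|exact H3] | exact Hd]).
Qed.

Lemma is_Cderive_mult (f g : C -> C) (z df dg : C) :
  is_Cderive f z df -> is_Cderive g z dg ->
  is_Cderive (fun y => f y * g y)%C z (df * g z + f z * dg)%C.
Proof.
rewrite !is_Cderive_AbsRing; intros Hf Hg.
exact (is_derive_mult (K := C_AbsRing) f g z df dg Hf Hg Cmult_comm).
Qed.

Lemma is_Cderive_comp (f g : C -> C) (z df dg : C) :
  is_Cderive f (g z) df -> is_Cderive g z dg ->
  is_Cderive (fun y => f (g y)) z (dg * df)%C.
Proof.
rewrite (is_Cderive_AbsRing g); intros Hf Hg.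
exact (is_derive_comp (K := C_AbsRing) (V := C_NormedModule) f g z df dg Hf Hg).
Qed.

Lemma is_Cderive_linear (k z : C) : is_Cderive (fun y => k * y)%C z k.
Proof.
apply is_Cderive_eps; intros eps; exists eps; intros y _.
replace (k * y - k * z - (y - z) * k)%C with (RtoC 0) by ring.
rewrite Cmod_0.
apply Rmult_le_pos; [apply Rlt_le, cond_pos | apply Cmod_ge_0].
Qed.

Lemma locally_C_Cmod (z : C) (delta : posreal) :
  locally (T := C_UniformSpace) z (fun y => Cmod (y - z) < delta)%R.
Proof.
exact (locally_le_locally_norm (V := C_NormedModule) z _
         (locally_norm_ball_norm (V := C_NormedModule) z delta)).
Qed.

(** A form of the inverse function rule that needs no inverse function: the
    increment of [E] is, near [z], at least [Cmod e / 2] times that of the variable, so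
    an error negligible with respect to [y - z] is negligible with respect to
    [E y - E z]. *)
Lemma Cderive_relative (E H : C -> C) (z e d : C) :
  is_Cderive E z e -> is_Cderive H z d -> e <> RtoC 0 ->
  forall eps : posreal, locally (T := C_UniformSpace) z (fun y =>
    Cmod (H y - H z - (E y - E z) * (d / e)) <= eps * Cmod (E y - E z))%R.
Proof.
intros HE HH He eps.
assert (He' : (0 < Cmod e)%R) by now apply Cmod_gt_0.
set (q := Cmod (d / e)).
assert (Hq : (0 <= q)%R) by apply Cmod_ge_0.
assert (Heta : (0 < Rmin (Cmod e / 2) (eps * (Cmod e / 2) / (1 + q)))%R).
{ apply Rmin_pos; [lra|].
  apply Rdiv_lt_0_compat; [|lra].
  apply Rmult_lt_0_compat; [apply cond_pos | lra]. }
set (eta := mkposreal _ Heta).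
assert (Heta1 : (eta <= Cmod e / 2)%R) by apply Rmin_l.
assert (Heta2 : (eta * (1 + q) <= eps * (Cmod e / 2))%R).
{ apply Rle_trans with (eps * (Cmod e / 2) / (1 + q) * (1 + q))%R.
  - apply Rmult_le_compat_r; [lra | apply Rmin_r].
  - right; field; lra. }
destruct (proj1 (is_Cderive_eps _ _ _) HE eta) as [d1 H1].
destruct (proj1 (is_Cderive_eps _ _ _) HH eta) as [d2 H2].
generalize (filter_and _ _ (locally_C_Cmod z d1) (locally_C_Cmod z d2)).
apply filter_imp; intros y [Hy1 Hy2].
specialize (H1 y Hy1); specialize (H2 y Hy2).
set (h := Cmod (y - z)) in *.
assert (Hh : (0 <= h)%R) by apply Cmod_ge_0.
assert (Hlow : (Cmod e / 2 * h <= Cmod (E y - E z))%R).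
{ assert (T := Cmod_triangle (E y - E z) (- (E y - E z - (y - z) * e))%C).
  rewrite Cmod_opp in T.
  replace (E y - E z + - (E y - E z - (y - z) * e))%C with ((y - z) * e)%C in T
    by ring.
  rewrite Cmod_mult in T; fold h in T.
  assert (eta * h <= Cmod e / 2 * h)%R by now apply Rmult_le_compat_r.
  lra. }
replace (H y - H z - (E y - E z) * (d / e))%C with
  ((H y - H z - (y - z) * d) + - ((E y - E z - (y - z) * e) * (d / e)))%C
  by (field; exact He).
eapply Rle_trans; [apply Cmod_triangle|].
rewrite Cmod_opp, Cmod_mult; fold q.
apply Rle_trans with (eta * (1 + q) * h)%R.
- assert (Cmod (E y - E z - (y - z) * e) * q <= eta * h * q)%R
    by now apply Rmult_le_compat_r.
  lra.
- apply Rle_trans with (eps * (Cmod e / 2) * h)%R.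
  + now apply Rmult_le_compat_r.
  + rewrite Rmult_assoc; apply Rmult_le_compat_l; [apply Rlt_le, cond_pos | exact Hlow].
Qed.

(** * The complex exponential *)

Lemma Cexp_plus (x y : C) : Cexp (x + y) = (Cexp x * Cexp y)%C.
Proof.
unfold Cexp, Cmult, Re, Im; simpl.
rewrite exp_plus, cos_plus, sin_plus; f_equal; ring.
Qed.

Lemma Cexp_0 : Cexp 0 = RtoC 1.
Proof.
unfold Cexp, RtoC; simpl.
rewrite exp_0, cos_0, sin_0, Rmult_0_r, Rmult_1_r; reflexivity.
Qed.

Lemma Cexp_neq_0 (z : C) : Cexp z <> RtoC 0.
Proof.
intros Hz; apply C1_nz.
rewrite <- Cexp_0, <- (Cplus_opp_r z), Cexp_plus, Hz; ring.
Qed.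

Lemma is_derive_R_eps (f : R -> R) (x l : R) :
  is_derive f x l ->
  forall eps : posreal, exists delta : posreal, forall y : R,
    (Rabs (y - x) < delta ->
     Rabs (f y - f x - (y - x) * l) <= eps * Rabs (y - x))%R.
Proof.
intros [_ Hd] eps.
destruct (Hd x (fun P HP => HP) eps) as [delta Hdelta].
exists delta; intros y Hy; exact (Hdelta y Hy).
Qed.

Lemma Cmod_le_Rabs (z : C) : (Cmod z <= Rabs (Re z) + Rabs (Im z))%R.
Proof.
destruct z as [x y]; simpl.
replace (x, y) with (RtoC x + Ci * RtoC y)%C
  by (unfold RtoC, Ci, Cplus, Cmult; simpl; f_equal; ring).
eapply Rle_trans; [apply Cmod_triangle|].
rewrite Cmod_mult, !Cmod_R.
replace (Cmod Ci) with 1%R; [lra|].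
unfold Cmod, Ci; simpl; rewrite <- sqrt_1 at 1; f_equal; ring.
Qed.

Lemma im_le_Cmod (z : C) : (Rabs (Im z) <= Cmod z)%R.
Proof.
eapply Rle_trans; [|apply Rmax_Cmod]; apply Rmax_r.
Qed.

(** The two components reduce to the real derivatives at [0] of [exp], [cos]
    and [sin], through [e^x cos y - 1 - x = (e^x - 1 - x) cos y +
    (1 + x) (cos y - 1)] and [e^x sin y - y = (e^x - 1) sin y + (sin y - y)]. *)
Lemma is_Cderive_Cexp_0 : is_Cderive Cexp (RtoC 0) (RtoC 1).
Proof.
apply is_Cderive_eps; intros eps.
(* The four terms bounded at the end contribute [1], [2], [4] and [1]
   times [m * h]. *)
assert (Hm : (0 < Rmin 1 (eps / 8))%R).
{ apply Rmin_pos; [lra|]; generalize (cond_pos eps); lra. }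
set (m := mkposreal _ Hm).
assert (Hm1 : (m <= 1)%R) by apply Rmin_l.
assert (Hm2 : (8 * m <= eps)%R)
  by (assert (m <= eps / 8)%R by apply Rmin_r; lra).
assert (m0 := cond_pos m).
destruct (is_derive_R_eps exp 0 (exp 0) (is_derive_exp 0) m) as [d1 H1].
destruct (is_derive_R_eps cos 0 (- sin 0) (is_derive_cos 0) m) as [d2 H2].
destruct (is_derive_R_eps sin 0 (cos 0) (is_derive_sin 0) m) as [d3 H3].
assert (Hd : (0 < Rmin m (Rmin d1 (Rmin d2 d3)))%R)
  by (apply Rmin_pos; [exact m0 | repeat apply Rmin_pos; apply cond_pos]).
exists (mkposreal _ Hd); intros [x y]; simpl; intros Hlt.
replace ((x, y) - 0)%C with ((x, y) : C) in *
  by (unfold RtoC, Cminus, Cplus, Copp; simpl; f_equal; ring).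
set (h := Cmod (x, y)) in *.
assert (hm : (h < m)%R) by (eapply Rlt_le_trans; [exact Hlt|apply Rmin_l]).
assert (hd : (h < Rmin d1 (Rmin d2 d3))%R)
  by (eapply Rlt_le_trans; [exact Hlt|apply Rmin_r]).
assert (hd1 : (h < d1)%R) by (eapply Rlt_le_trans; [exact hd|apply Rmin_l]).
assert (hd' : (h < Rmin d2 d3)%R)
  by (eapply Rlt_le_trans; [exact hd|apply Rmin_r]).
assert (hd2 : (h < d2)%R) by (eapply Rlt_le_trans; [exact hd'|apply Rmin_l]).
assert (hd3 : (h < d3)%R) by (eapply Rlt_le_trans; [exact hd'|apply Rmin_r]).
assert (hx : (Rabs x <= h)%R) by exact (re_le_Cmod (x, y)).
assert (hy : (Rabs y <= h)%R) by exact (im_le_Cmod (x, y)).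
specialize (H1 x); specialize (H2 y); specialize (H3 y).
rewrite exp_0, Rminus_0_r in H1; rewrite cos_0, sin_0, Rminus_0_r in H2, H3.
replace (cos y - 1 - y * - 0)%R with (cos y - 1)%R in H2 by ring.
replace (sin y - 0 - y * 1)%R with (sin y - y)%R in H3 by ring.
rewrite Rmult_1_r in H1.
specialize (H1 ltac:(lra)); specialize (H2 ltac:(lra)); specialize (H3 ltac:(lra)).
assert (H1' : (Rabs (exp x - 1 - x) <= m * h)%R).
{ eapply Rle_trans; [exact H1|]; apply Rmult_le_compat_l; lra. }
assert (H2' : (Rabs (cos y - 1) <= m * h)%R).
{ eapply Rle_trans; [exact H2|]; apply Rmult_le_compat_l; lra. }
assert (H3' : (Rabs (sin y - y) <= m * h)%R).
{ eapply Rle_trans; [exact H3|]; apply Rmult_le_compat_l; lra. }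
assert (h0 : (0 <= h)%R) by apply Cmod_ge_0.
assert (mh : (m * h <= h)%R) by nra.
assert (Hex : (Rabs (exp x - 1) <= 2 * h)%R).
{ replace (exp x - 1)%R with ((exp x - 1 - x) + x)%R by ring.
  eapply Rle_trans; [apply Rabs_triang|]; lra. }
assert (Hc : (Rabs (cos y) <= 1)%R)
  by (apply Rabs_le; generalize (COS_bound y); lra).
assert (Hx1 : (Rabs (1 + x) <= 2)%R).
{ eapply Rle_trans; [apply Rabs_triang|]; rewrite Rabs_R1; lra. }
assert (Hsin : (Rabs (sin y) <= 2 * h)%R).
{ replace (sin y) with ((sin y - y) + y)%R by ring.
  eapply Rle_trans; [apply Rabs_triang|]; lra. }
rewrite Cexp_0.
eapply Rle_trans; [apply Cmod_le_Rabs|].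
unfold Cexp; simpl.
replace (exp x * cos y + - (1) + - (x * 1 - y * 0))%R with
  ((exp x - 1 - x) * cos y + (1 + x) * (cos y - 1))%R by ring.
replace (exp x * sin y + - 0 + - (x * 0 + y * 1))%R with
  ((exp x - 1) * sin y + (sin y - y))%R by ring.
assert (K1 := Rabs_triang ((exp x - 1 - x) * cos y) ((1 + x) * (cos y - 1))).
assert (K2 := Rabs_triang ((exp x - 1) * sin y) (sin y - y)).
rewrite !Rabs_mult in K1; rewrite Rabs_mult in K2.
assert (B1 : (Rabs (exp x - 1 - x) * Rabs (cos y) <= (m * h) * 1)%R)
  by (apply Rmult_le_compat; auto using Rabs_pos).
assert (B2 : (Rabs (1 + x) * Rabs (cos y - 1) <= 2 * (m * h))%R)
  by (apply Rmult_le_compat; auto using Rabs_pos).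
assert (B3 : (Rabs (exp x - 1) * Rabs (sin y) <= (2 * h) * (2 * h))%R)
  by (apply Rmult_le_compat; auto using Rabs_pos).
assert (B4 : (h * h <= m * h)%R) by (apply Rmult_le_compat_r; lra).
assert (B5 : (8 * m * h <= eps * h)%R) by (apply Rmult_le_compat_r; lra).
fold h; lra.
Qed.

Lemma is_Cderive_Cexp (z : C) : is_Cderive Cexp z (Cexp z).
Proof.
apply is_Cderive_eps; intros eps.
assert (Hz : (0 < Cmod (Cexp z))%R) by apply Cmod_gt_0, Cexp_neq_0.
assert (He : (0 < eps / Cmod (Cexp z))%R)
  by (apply Rdiv_lt_0_compat; [apply cond_pos | exact Hz]).
destruct (proj1 (is_Cderive_eps _ _ _) is_Cderive_Cexp_0 (mkposreal _ He))
  as [delta Hdelta].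
exists delta; intros y Hy.
specialize (Hdelta (y - z)%C).
replace (y - z - 0)%C with (y - z)%C in Hdelta by ring.
specialize (Hdelta Hy); simpl in Hdelta.
replace (Cexp y - Cexp z - (y - z) * Cexp z)%C with
  (Cexp z * (Cexp (y - z) - Cexp 0 - (y - z) * 1))%C.
- rewrite Cmod_mult.
  apply Rle_trans with (Cmod (Cexp z) * (eps / Cmod (Cexp z) * Cmod (y - z)))%R.
  + apply Rmult_le_compat_l; [now apply Rlt_le | exact Hdelta].
  + right; field; lra.
- rewrite Cexp_0; replace y with ((y - z) + z)%C at 3 by ring.
  rewrite Cexp_plus; ring.
Qed.

(** * Complex power series *)

Notation is_Cseries := (is_series (K := C_AbsRing) (V := C_NormedModule)).

Lemma is_Cseries_ext (u v : nat -> C) (l : C) :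
  (forall k, u k = v k) -> is_Cseries u l -> is_Cseries v l.
Proof.
exact (is_series_ext (K := C_AbsRing) (V := C_NormedModule) u v l).
Qed.

Lemma is_Cseries_plus (u v : nat -> C) (l m : C) :
  is_Cseries u l -> is_Cseries v m ->
  is_Cseries (fun k => u k + v k)%C (l + m)%C.
Proof.
exact (is_series_plus (K := C_AbsRing) (V := C_NormedModule) u v l m).
Qed.

Lemma is_Cseries_scal (c : C) (u : nat -> C) (l : C) :
  is_Cseries u l -> is_Cseries (fun k => c * u k)%C (c * l)%C.
Proof.
exact (is_series_scal (K := C_AbsRing) (V := C_NormedModule) c u l).
Qed.

Lemma is_Cseries_CSeries (u : nat -> C) :
  ex_series (fun k => Cmod (u k)) -> is_Cseries u (CSeries u).
Proof.
intros Hu.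
destruct (ex_series_le (K := C_AbsRing) (V := C_CompleteNormedModule)
            u (fun k => Cmod (u k))) as [l Hl].
- intros k; apply Rle_refl.
- exact Hu.
- rewrite (CSeries_unique u l Hl); exact Hl.
Qed.

Lemma Cmod_Cseries_le (u : nat -> C) (b : nat -> R) (l : C) (m : R) :
  (forall k, Cmod (u k) <= b k)%R -> is_Cseries u l -> is_series b m ->
  (Cmod l <= m)%R.
Proof.
intros Hub Hu Hb.
apply (is_lim_seq_le (fun n => Cmod (sum_n (G := C_AbelianMonoid) u n))
         (sum_n b) (Cmod l) m).
- intros n.
  eapply Rle_trans; [exact (norm_sum_n_m (K := C_AbsRing) (V := C_NormedModule) u 0 n)|].
  apply sum_n_m_le; exact Hub.
- eapply filterlim_comp; [exact Hu|].
  exact (filterlim_norm (K := C_AbsRing) (V := C_NormedModule) l).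
- exact Hb.
Qed.

Definition CPSeries (u : nat -> C) (z : C) : C := CSeries (fun k => u k * z ^ k)%C.

Definition CPS_derive (u : nat -> C) (k : nat) : C := (RtoC (INR (S k)) * u (S k))%C.

Definition in_Cdisk (u : nat -> C) (z : C) : Prop :=
  Rbar_lt (Cmod z) (CV_radius (fun k => Cmod (u k))).

Lemma ex_series_Cmod_Cdisk (u : nat -> C) (z : C) :
  in_Cdisk u z -> ex_series (fun k => Cmod (u k * z ^ k)%C).
Proof.
intros Hz.
assert (Hr : Rbar_lt (Rabs (Cmod z)) (CV_radius (fun k => Cmod (u k))))
  by (rewrite (Rabs_pos_eq _ (Cmod_ge_0 z)); exact Hz).
eapply ex_series_ext; [|exact (CV_disk_inside _ _ Hr)].
intros k; simpl.
rewrite Cmod_mult, Cmod_pow; apply Rabs_pos_eq.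
apply Rmult_le_pos; [apply Cmod_ge_0 | apply pow_le, Cmod_ge_0].
Qed.

Lemma is_CPSeries (u : nat -> C) (z : C) :
  in_Cdisk u z -> is_Cseries (fun k => u k * z ^ k)%C (CPSeries u z).
Proof.
intros Hz; apply is_Cseries_CSeries, ex_series_Cmod_Cdisk, Hz.
Qed.

Lemma in_Cdisk_derive (u : nat -> C) (z : C) :
  in_Cdisk u z -> in_Cdisk (CPS_derive u) z.
Proof.
unfold in_Cdisk; intros Hz.
rewrite <- CV_radius_derive in Hz.
erewrite CV_radius_ext; [exact Hz|].
intros k; unfold CPS_derive, PS_derive.
rewrite Cmod_mult, Cmod_R, Rabs_pos_eq; [reflexivity | apply pos_INR].
Qed.

(** The operator [z d/dz] multiplies the coefficient of index [k] by [k]. *)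
Lemma is_CPSeries_euler (u : nat -> C) (z : C) :
  in_Cdisk u z ->
  is_Cseries (fun k => RtoC (INR k) * (u k * z ^ k))%C
    (z * CPSeries (CPS_derive u) z)%C.
Proof.
intros Hz.
apply (is_series_decr_1 (K := C_AbsRing) (V := C_NormedModule)).
match goal with |- is_series _ ?l =>
  replace l with (z * CPSeries (CPS_derive u) z)%C end.
- eapply is_Cseries_ext;
    [|exact (is_Cseries_scal z _ _ (is_CPSeries _ _ (in_Cdisk_derive _ _ Hz)))].
  intros k; unfold CPS_derive; rewrite Cpow_S; simpl; ring.
- change (z * CPSeries (CPS_derive u) z
    = z * CPSeries (CPS_derive u) z + - (RtoC (INR 0) * (u 0%nat * z ^ 0)))%C.
  simpl; ring.
Qed.

(** The second-order Taylor estimate for [z ^ (k + 2)], with the bound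
    [(k + 1) (k + 2) r ^ k] for its second derivative on the disk of radius
    [r].  By induction: for [h = w - z], the remainders satisfy
    [R_(n+1) = w R_n + n z ^ (n - 1) h ^ 2]. *)
Lemma Cpow_taylor_bound (r : R) (w z : C) (k : nat) :
  (Cmod w <= r)%R -> (Cmod z <= r)%R ->
  (Cmod (w ^ S (S k) - z ^ S (S k) - RtoC (INR (S (S k))) * z ^ S k * (w - z))
   <= INR (S k) * INR (S (S k)) * r ^ k * (Cmod (w - z) * Cmod (w - z)))%R.
Proof.
intros Hw Hz.
assert (r0 : (0 <= r)%R) by (eapply Rle_trans; [apply Cmod_ge_0 | exact Hw]).
set (h := Cmod (w - z)).
assert (h0 : (0 <= h)%R) by apply Cmod_ge_0.
induction k as [|k IH].
- replace (w ^ 2 - z ^ 2 - RtoC (INR 2) * z ^ 1 * (w - z))%C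
    with ((w - z) * (w - z))%C.
  + rewrite Cmod_mult; fold h; simpl; nra.
  + replace (INR 2) with (1 + 1)%R by (simpl; ring).
    rewrite RtoC_plus; simpl; ring.
- set (n := S (S k)) in *.
  replace (w ^ S n - z ^ S n - RtoC (INR (S n)) * z ^ n * (w - z))%C with
   (w * (w ^ n - z ^ n - RtoC (INR n) * z ^ S k * (w - z))
    + RtoC (INR n) * z ^ S k * ((w - z) * (w - z)))%C.
  2:{ rewrite (S_INR n), RtoC_plus, (Cpow_S w n), (Cpow_S z n).
      change (z ^ n)%C with (z * z ^ S k)%C; ring. }
  eapply Rle_trans; [apply Cmod_triangle|].
  rewrite !Cmod_mult, Cmod_pow, Cmod_R, (Rabs_pos_eq _ (pos_INR n)); fold h.
  assert (Hn : (0 <= INR n)%R) by apply pos_INR.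
  assert (rk : (0 <= r ^ S k)%R) by now apply pow_le.
  assert (B1 : (Cmod w * Cmod (w ^ n - z ^ n - RtoC (INR n) * z ^ S k * (w - z))
          <= r * (INR (S k) * INR n * r ^ k * (h * h)))%R)
    by (apply Rmult_le_compat; auto using Cmod_ge_0).
  assert (B2 : (INR n * Cmod z ^ S k * (h * h) <= INR n * r ^ S k * (h * h))%R).
  { apply Rmult_le_compat_r; [nra|]; apply Rmult_le_compat_l; [exact Hn|].
    apply pow_incr; split; [apply Cmod_ge_0 | exact Hz]. }
  replace (r * (INR (S k) * INR n * r ^ k * (h * h)))%R with
    (INR (S k) * (INR n * r ^ S k * (h * h)))%R in B1 by (simpl; ring).
  rewrite (S_INR n).
  replace (INR n * (INR n + 1) * r ^ S k * (h * h))%R with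
    ((INR n + 1) * (INR n * r ^ S k * (h * h)))%R by ring.
  assert (HnS : INR n = (INR (S k) + 1)%R) by apply S_INR.
  assert (P : (0 <= INR n * r ^ S k * (h * h))%R)
    by (apply Rmult_le_pos; [now apply Rmult_le_pos | nra]).
  rewrite HnS at 2; nra.
Qed.

(** Summing the Taylor estimates of the monomials on a disk of radius [r]
    strictly between [Cmod z] and the radius of convergence bounds the
    remainder by [Cmod (w - z) ^ 2] times the sum at [r] of the twice
    differentiated series of moduli, which converges because differentiation
    preserves the radius of convergence. *)
Lemma is_Cderive_CPSeries (u : nat -> C) (z : C) :
  in_Cdisk u z -> is_Cderive (CPSeries u) z (CPSeries (CPS_derive u) z).
Proof.
intros Hz.
assert (Hr : exists r : R, (Cmod z < r)%R /\ in_Cdisk u (RtoC r)).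
{ unfold in_Cdisk in *.
  destruct (CV_radius (fun k => Cmod (u k))) as [R0| |]; simpl in Hz.
  - exists ((Cmod z + R0) / 2)%R.
    rewrite Cmod_R, Rabs_pos_eq; simpl; [lra|].
    generalize (Cmod_ge_0 z); lra.
  - exists (Cmod z + 1)%R; simpl; split; [lra | exact I].
  - contradiction. }
destruct Hr as [r [Hzr Hr]].
assert (r0 : (0 <= r)%R) by (generalize (Cmod_ge_0 z); lra).
destruct (ex_series_Cmod_Cdisk _ _ (in_Cdisk_derive _ _ (in_Cdisk_derive _ _ Hr)))
  as [M HM].
assert (Hbound : forall w : C, (Cmod w <= r)%R ->
  (Cmod (CPSeries u w - CPSeries u z - (w - z) * CPSeries (CPS_derive u) z)
   <= Cmod (w - z) * Cmod (w - z) * M)%R).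
{ intros w Hw.
  assert (Hdisk : forall y : C, (Cmod y <= r)%R -> in_Cdisk u y).
  { intros y Hy; unfold in_Cdisk in *.
    rewrite Cmod_R, (Rabs_pos_eq r r0) in Hr.
    exact (Rbar_le_lt_trans (Cmod y) r _ Hy Hr). }
  assert (Hzd : in_Cdisk u z) by (apply Hdisk; lra).
  set (t := fun k : nat =>
    (u (S (S k)) * (w ^ S (S k) - z ^ S (S k)
        - RtoC (INR (S (S k))) * z ^ S k * (w - z)))%C).
  apply (Cmod_Cseries_le t
    (fun k => Cmod (w - z) * Cmod (w - z)
       * Cmod (CPS_derive (CPS_derive u) k * RtoC r ^ k))%R).
  - intros k; unfold t, CPS_derive.
    rewrite !Cmod_mult, Cmod_pow, !Cmod_R, (Rabs_pos_eq r r0).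
    rewrite (Rabs_pos_eq _ (pos_INR (S k))), (Rabs_pos_eq _ (pos_INR (S (S k)))).
    assert (B := Cpow_taylor_bound r w z k Hw (Rlt_le _ _ Hzr)).
    apply (Rmult_le_compat_l (Cmod (u (S (S k)))) _ _ (Cmod_ge_0 _)) in B.
    eapply Rle_trans; [exact B | right; ring].
  -
    (* [s] is the whole expansion of the remainder; its terms of index [0]
       and [1] vanish, and [t] is what is left. *)
    set (s := fun k : nat => (u k * w ^ k + - (1) * (u k * z ^ k)
        + - (w - z) * match k with O => 0 | S j => CPS_derive u j * z ^ j end)%C).
    assert (Hs : is_Cseries s (CPSeries u w + - (1) * CPSeries u z
        + - (w - z) * CPSeries (CPS_derive u) z)%C).
    { apply is_Cseries_plus; [apply is_Cseries_plus|].
      - now apply is_CPSeries, Hdisk.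
      - now apply is_Cseries_scal, is_CPSeries.
      - apply is_Cseries_scal.
        apply (is_series_decr_1 (K := C_AbsRing) (V := C_NormedModule)).
        match goal with |- is_series _ ?l =>
          replace l with (CPSeries (CPS_derive u) z) end.
        + exact (is_CPSeries _ _ (in_Cdisk_derive _ _ Hzd)).
        + change (CPSeries (CPS_derive u) z
            = CPSeries (CPS_derive u) z + - RtoC 0)%C; ring. }
    apply (is_Cseries_ext (fun k => s (S (S k)))).
    { intros k; unfold s, t, CPS_derive; ring. }
    replace (CPSeries u w - CPSeries u z - (w - z) * CPSeries (CPS_derive u) z)%C
      with (CPSeries u w + - (1) * CPSeries u z
        + - (w - z) * CPSeries (CPS_derive u) z)%C by ring.
    apply (is_series_incr_1 (K := C_AbsRing) (V := C_NormedModule) (fun k => s (S k))).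
    apply (is_series_incr_1 (K := C_AbsRing) (V := C_NormedModule) s).
    match goal with |- is_series _ ?l =>
      replace l with (CPSeries u w + - (1) * CPSeries u z
        + - (w - z) * CPSeries (CPS_derive u) z)%C end; [exact Hs|].
    assert (s0 : s 0%nat = RtoC 0) by (unfold s; simpl; ring).
    assert (s1 : s 1%nat = RtoC 0) by (unfold s, CPS_derive; simpl; ring).
    rewrite s0, s1.
    match goal with |- ?x = _ => change (x = x + RtoC 0 + RtoC 0)%C end; ring.
  - exact (is_series_scal_l (K := R_AbsRing) (V := R_NormedModule)
             (Cmod (w - z) * Cmod (w - z))%R _ M HM). }
apply is_Cderive_eps; intros eps.
assert (Hd : (0 < Rmin (r - Cmod z) (eps / (1 + Rabs M)))%R).
{ apply Rmin_pos; [lra|].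
  apply Rdiv_lt_0_compat; [apply cond_pos | generalize (Rabs_pos M); lra]. }
exists (mkposreal _ Hd); simpl; intros w Hw.
assert (Hw1 : (Cmod (w - z) < r - Cmod z)%R)
  by (eapply Rlt_le_trans; [exact Hw | apply Rmin_l]).
assert (Hw2 : (Cmod (w - z) < eps / (1 + Rabs M))%R)
  by (eapply Rlt_le_trans; [exact Hw | apply Rmin_r]).
eapply Rle_trans.
- apply Hbound.
  replace w with ((w - z) + z)%C by ring.
  eapply Rle_trans; [apply Cmod_triangle | lra].
- assert (h0 := Cmod_ge_0 (w - z)).
  rewrite (Rmult_comm eps), Rmult_assoc.
  apply Rmult_le_compat_l; [exact h0|].
  assert (M0 := Rabs_pos M); assert (M1 := Rle_abs M).
  apply Rle_trans with (eps / (1 + Rabs M) * (1 + Rabs M))%R.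
  + apply Rle_trans with (Cmod (w - z) * (1 + Rabs M))%R.
    * apply Rmult_le_compat_l; lra.
    * apply Rmult_le_compat_r; lra.
  + right; field; lra.
Qed.

(** * The ratio test and the hypergeometric coefficients *)

Lemma eventually_nonincreasing_bounded (b : nat -> R) (N : nat) :
  (forall n, (N <= n)%nat -> b (S n) <= b n)%R ->
  exists M : R, forall n, (b n <= M)%R.
Proof.
revert b; induction N as [|N IH]; intros b Hb.
- exists (b 0%nat); induction n as [|n IHn]; [apply Rle_refl|].
  eapply Rle_trans; [apply Hb; lia | exact IHn].
- destruct (IH (fun n => b (S n))) as [M HM].
  + intros n Hn; apply Hb; lia.
  + exists (Rmax (b 0%nat) M); intros [|n]; [apply Rmax_l|].
    eapply Rle_trans; [apply HM | apply Rmax_r].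
Qed.

(** Stated with a multiplication instead of a quotient, because the
    coefficients vanish from some index on when an upper parameter is a
    nonpositive integer.  For some [r > Cmod z] one still has [l * r < 1],
    hence [Cmod (u k) * r ^ k] is eventually nonincreasing and so bounded. *)
Lemma in_Cdisk_ratio (u : nat -> C) (rho : nat -> R) (l : R) (z : C) :
  (forall k, Cmod (u (S k)) = rho k * Cmod (u k))%R ->
  is_lim_seq rho l -> (l * Cmod z < 1)%R -> in_Cdisk u z.
Proof.
intros Hu Hrho Hl.
(* Half of the room left by [l * Cmod z < 1]; adding [Rabs l] to the
   denominator covers every sign and size of [l]. *)
set (e := ((1 - l * Cmod z) / (2 * (1 + Rabs l)))%R).
assert (l0 := Rabs_pos l); assert (l1 := Rle_abs l).
assert (z0 := Cmod_ge_0 z).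
assert (e0 : (0 < e)%R) by (apply Rdiv_lt_0_compat; lra).
assert (He : (e * (1 + Rabs l) = (1 - l * Cmod z) / 2)%R)
  by (unfold e; field; lra).
set (r := (Cmod z + e)%R).
assert (r0 : (0 < r)%R) by (unfold r; lra).
assert (Hlr : (l * r < 1)%R) by (unfold r; nra).
assert (Hle : Rbar_le r (CV_radius (fun k => Cmod (u k)))).
{ apply (CV_radius_bounded (fun k => Cmod (u k))).
  assert (Hlim : is_lim_seq (fun k => rho k * r)%R (l * r)%R)
    by exact (is_lim_seq_scal_r rho r l Hrho).
  assert (Hpos : (0 < 1 - l * r)%R) by lra.
  destruct (proj2 (is_lim_seq_spec _ _) Hlim (mkposreal _ Hpos)) as [N HN].
  destruct (eventually_nonincreasing_bounded (fun k => Cmod (u k) * r ^ k)%R N)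
    as [M HM].
  - intros n Hn; rewrite Hu.
    specialize (HN n Hn); simpl in HN; apply Rabs_lt_between in HN.
    assert (P : (0 <= Cmod (u n) * r ^ n)%R)
      by (apply Rmult_le_pos; [apply Cmod_ge_0 | apply pow_le; lra]).
    replace (rho n * Cmod (u n) * r ^ S n)%R with
      ((rho n * r) * (Cmod (u n) * r ^ n))%R by (simpl; ring).
    nra.
  - exists M; intros n; rewrite Rabs_pos_eq; [apply HM|].
    apply Rmult_le_pos; [apply Cmod_ge_0 | apply pow_le; lra]. }
apply (Rbar_lt_le_trans _ r); [simpl; unfold r; lra | exact Hle].
Qed.

Definition hyp_coef (a c : list C) (k : nat) : C :=
  (Cprod (map (fun ai => pochhammer ai k) a)
   / Cprod (map (fun cj => pochhammer cj k) c) / RtoC (INR (fact k)))%C.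

Lemma CSeries_ext (u v : nat -> C) :
  (forall k, u k = v k) -> CSeries u = CSeries v.
Proof.
intros H; unfold CSeries; f_equal; apply Series_ext; intros k; now rewrite H.
Qed.

Lemma pFq_CPSeries (a c : list C) (x : C) : pFq a c x = CPSeries (hyp_coef a c) x.
Proof.
apply CSeries_ext; intros k; unfold hyp_coef, Cdiv; ring.
Qed.

Lemma RtoC_INR_neq_0 (n : nat) : n <> 0%nat -> RtoC (INR n) <> RtoC 0.
Proof.
intros Hn H; apply RtoC_inj in H; now apply (not_0_INR n).
Qed.

Lemma add_INR_neq_0 (c : C) (k : nat) :
  ~ positive_integer (1 - c)%C -> (c + RtoC (INR k))%C <> RtoC 0.
Proof.
intros Hc H; apply Hc; exists (S k); split; [lia|].
rewrite S_INR, RtoC_plus.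
replace (RtoC (INR k)) with ((c + RtoC (INR k)) - c)%C by ring.
rewrite H; ring.
Qed.

Lemma pochhammer_neq_0 (c : C) (k : nat) :
  ~ positive_integer (1 - c)%C -> pochhammer c k <> RtoC 0.
Proof.
intros Hc; induction k as [|k IH]; simpl; [exact C1_nz|].
apply Cmult_neq_0; [exact IH | now apply add_INR_neq_0].
Qed.

Lemma Cprod_map_neq_0 (f : C -> C) (s : list C) :
  (forall x, In x s -> f x <> RtoC 0) -> Cprod (map f s) <> RtoC 0.
Proof.
induction s as [|x s IH]; intros H; simpl; [exact C1_nz|].
apply Cmult_neq_0; [apply H; now left | apply IH; intros y Hy; apply H; now right].
Qed.

Lemma Cprod_map_mult (f g : C -> C) (s : list C) :
  Cprod (map (fun x => f x * g x)%C s) = (Cprod (map f s) * Cprod (map g s))%C.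
Proof.
induction s as [|x s IH]; simpl; [ring | rewrite IH; ring].
Qed.

Lemma Cprod_map_snoc (f : C -> C) (s : list C) (x : C) :
  Cprod (map f (s ++ [x])) = (Cprod (map f s) * f x)%C.
Proof.
induction s as [|y s IH]; simpl; [ring | rewrite IH; ring].
Qed.

Definition shift_prod (s : list C) (k : nat) : C :=
  Cprod (map (fun x => x + RtoC (INR k))%C s).

Lemma hyp_coef_S (a c : list C) (k : nat) :
  (forall cj, In cj c -> ~ positive_integer (1 - cj)%C) ->
  hyp_coef a c (S k)
  = (shift_prod a k / (shift_prod c k * RtoC (INR (S k))) * hyp_coef a c k)%C.
Proof.
intros Hc; unfold hyp_coef, shift_prod.
simpl pochhammer; rewrite !Cprod_map_mult.
rewrite fact_simpl, mult_INR, RtoC_mult.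
assert (RtoC (INR (S k)) <> RtoC 0) by (apply RtoC_INR_neq_0; lia).
assert (RtoC (INR (fact k)) <> RtoC 0) by apply RtoC_INR_neq_0, fact_neq_0.
assert (Cprod (map (fun x => pochhammer x k) c) <> RtoC 0)
  by (apply Cprod_map_neq_0; intros x Hx; now apply pochhammer_neq_0, Hc).
assert (Cprod (map (fun x => x + RtoC (INR k))%C c) <> RtoC 0)
  by (apply Cprod_map_neq_0; intros x Hx; now apply add_INR_neq_0, Hc).
field; repeat split; assumption.
Qed.

Lemma is_lim_seq_inv_S : is_lim_seq (fun k => / INR (S k))%R 0.
Proof.
apply (is_lim_seq_incr_1 (fun k => / INR k)%R).
exact (is_lim_seq_inv INR p_infty is_lim_seq_INR ltac:(discriminate)).
Qed.

Lemma is_lim_seq_shift (x : C) :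
  is_lim_seq (fun k => Cmod (x + RtoC (INR k)) / INR (S k))%R 1.
Proof.
set (A := Cmod (x - 1)).
assert (Hs : forall t : R, is_lim_seq (fun k => 1 + t * / INR (S k))%R 1).
{ intros t; replace (Finite 1) with (Finite (1 + t * 0)) by (f_equal; ring).
  exact (is_lim_seq_plus' _ _ _ _ (is_lim_seq_const 1)
           (is_lim_seq_scal_l _ t 0 is_lim_seq_inv_S)). }
apply (is_lim_seq_le_le (fun k => 1 + - A * / INR (S k))%R _
         (fun k => 1 + A * / INR (S k))%R); [|apply Hs|apply Hs].
intros k.
assert (n0 : (0 < INR (S k))%R) by (apply lt_0_INR; lia).
assert (HS : Cmod (RtoC (INR (S k))) = INR (S k))
  by (rewrite Cmod_R; apply Rabs_pos_eq; lra).
assert (Hx : (x + RtoC (INR k) = RtoC (INR (S k)) + (x - 1))%C)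
  by (rewrite S_INR, RtoC_plus; ring).
rewrite Hx.
assert (T1 := Cmod_triangle (RtoC (INR (S k))) (x - 1)).
assert (T2 := Cmod_triangle (RtoC (INR (S k)) + (x - 1)) (- (x - 1))).
replace (RtoC (INR (S k)) + (x - 1) + - (x - 1))%C with (RtoC (INR (S k))) in T2
  by ring.
rewrite Cmod_opp in T2; rewrite HS in T1, T2; fold A in T1, T2.
split; apply (Rmult_le_reg_r (INR (S k))); try exact n0.
- replace ((1 + - A * / INR (S k)) * INR (S k))%R with (INR (S k) - A)%R
    by (field; lra).
  unfold Rdiv; rewrite Rmult_assoc, Rinv_l; lra.
- replace ((1 + A * / INR (S k)) * INR (S k))%R with (INR (S k) + A)%R
    by (field; lra).
  unfold Rdiv; rewrite Rmult_assoc, Rinv_l; lra.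
Qed.

(** Normalising each product of shifted parameters by its own power of
    [k + 1] gives it limit [1]; the ratio of consecutive coefficients is then
    governed by the power [q + 1 - p] of [1 / (k + 1)], for [p] upper and [q]
    lower parameters. *)
Lemma is_lim_seq_shift_prod (s : list C) :
  is_lim_seq (fun k => Cmod (shift_prod s k) / INR (S k) ^ length s)%R 1.
Proof.
induction s as [|x s IH].
- eapply is_lim_seq_ext; [|apply is_lim_seq_const].
  intros k; unfold shift_prod; simpl.
  rewrite Cmod_1; unfold Rdiv; rewrite Rinv_1; ring.
- replace (Finite 1) with (Finite (1 * 1)) by (f_equal; ring).
  eapply is_lim_seq_ext; [|exact (is_lim_seq_mult' _ _ _ _ (is_lim_seq_shift x) IH)].
  intros k; unfold shift_prod; cbn [map Cprod fold_right length pow].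
  rewrite Cmod_mult; unfold Cprod; field.
  split; [apply pow_nonzero|]; apply not_0_INR; lia.
Qed.

(** The factor leading from one coefficient to the next tends in modulus to [1]
    if [p = q + 1] and to [0] if [p <= q], for [p] upper and [q] lower
    parameters. *)
Lemma in_Cdisk_hyp_coef (a c : list C) (x : C) :
  (length a <= length c + 1)%nat ->
  (forall cj, In cj c -> ~ positive_integer (1 - cj)%C) ->
  (length a = (length c + 1)%nat -> (Cmod x < 1)%R) ->
  in_Cdisk (hyp_coef a c) x.
Proof.
intros Hlen Hc Hx.
set (m := (length c + 1 - length a)%nat).
set (l := match m with O => 1%R | S _ => 0%R end).
apply (in_Cdisk_ratio _
  (fun k => Cmod (shift_prod a k / (shift_prod c k * RtoC (INR (S k))))) l).
- intros k; rewrite (hyp_coef_S a c k Hc); apply Cmod_mult.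
- assert (Hm : is_lim_seq (fun k => (/ INR (S k)) ^ m)%R l).
  { unfold l; destruct m as [|m']; [apply is_lim_seq_const|].
    induction m' as [|m' IH].
    - eapply is_lim_seq_ext; [|exact is_lim_seq_inv_S]; intros k; simpl; ring.
    - replace (Finite 0) with (Finite (0 * 0)) by (f_equal; ring).
      exact (is_lim_seq_mult' _ _ _ _ is_lim_seq_inv_S IH). }
  replace (Finite l) with (Finite (1 * / 1 * l)) by (f_equal; field).
  eapply is_lim_seq_ext; [|exact (is_lim_seq_mult' _ _ _ _
    (is_lim_seq_mult' _ _ _ _ (is_lim_seq_shift_prod a)
      (is_lim_seq_inv _ 1 (is_lim_seq_shift_prod c)
         ltac:(intros H; injection H; exact R1_neq_R0))) Hm)].
  intros k; cbv beta.
  assert (n0 : INR (S k) <> 0%R) by (apply not_0_INR; lia).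
  assert (Hn0 : RtoC (INR (S k)) <> RtoC 0) by (apply RtoC_INR_neq_0; lia).
  assert (Hs0 : shift_prod c k <> RtoC 0).
  { apply Cprod_map_neq_0; intros y Hy; now apply add_INR_neq_0, Hc. }
  assert (Hs : Cmod (shift_prod c k) <> 0%R).
  { intros H; now apply Hs0, Cmod_eq_0. }
  rewrite Cmod_div by (now apply Cmult_neq_0).
  rewrite Cmod_mult, Cmod_R, (Rabs_pos_eq _ (pos_INR (S k))).
  assert (Hp : (INR (S k) ^ m * INR (S k) ^ length a
      = INR (S k) ^ length c * INR (S k))%R).
  { transitivity (INR (S k) ^ (length c + 1))%R.
    - rewrite <- pow_add; f_equal; unfold m; lia.
    - rewrite pow_add, pow_1; reflexivity. }
  assert (P1 : (INR (S k) ^ length a <> 0)%R) by now apply pow_nonzero.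
  assert (P2 : (INR (S k) ^ length c <> 0)%R) by now apply pow_nonzero.
  assert (P3 : (INR (S k) ^ m <> 0)%R) by now apply pow_nonzero.
  rewrite pow_inv.
  assert (Q : (Cmod (shift_prod a k) / (Cmod (shift_prod c k) * INR (S k))
    = Cmod (shift_prod a k) * INR (S k) ^ length c
      / (Cmod (shift_prod c k) * (INR (S k) ^ length c * INR (S k))))%R)
    by (field; repeat split; assumption).
  rewrite Q, <- Hp; field; repeat split; assumption.
- unfold l; destruct m as [|m'] eqn:Em; [|lra].
  unfold m in Em; rewrite Rmult_1_l; apply Hx; lia.
Qed.

(** * The Euler equation *)

(** Both sides are the product [s (s + 1) ... (s + k)]. *)
Lemma pochhammer_shift (s : C) (k : nat) :
  (s * pochhammer (1 + s) k = (s + RtoC (INR k)) * pochhammer s k)%C.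
Proof.
induction k as [|k IH].
- simpl; ring.
- cbn [pochhammer]; rewrite S_INR, RtoC_plus, Cmult_assoc, IH; ring.
Qed.

Lemma hyp_coef_raise (a c : list C) (s : C) (k : nat) :
  (forall cj, In cj c -> ~ positive_integer (1 - cj)%C) ->
  ~ positive_integer (- s)%C ->
  ((s + RtoC (INR k)) * hyp_coef (a ++ [s]) (c ++ [1 + s]) k
   = s * hyp_coef a c k)%C.
Proof.
intros Hc Hs.
assert (H1 : pochhammer (1 + s) k <> RtoC 0).
{ apply pochhammer_neq_0; intros H; apply Hs.
  now replace (- s)%C with (1 - (1 + s))%C by ring. }
assert (H2 : Cprod (map (fun cj => pochhammer cj k) c) <> RtoC 0).
{ apply Cprod_map_neq_0; intros x Hx; now apply pochhammer_neq_0, Hc. }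
assert (H3 : RtoC (INR (fact k)) <> RtoC 0)
  by apply RtoC_INR_neq_0, fact_neq_0.
unfold hyp_coef; rewrite !Cprod_map_snoc.
transitivity ((s + RtoC (INR k)) * pochhammer s k
  * Cprod (map (fun ai => pochhammer ai k) a)
  / (Cprod (map (fun cj => pochhammer cj k) c) * pochhammer (1 + s) k
     * RtoC (INR (fact k))))%C.
- field; repeat split; assumption.
- rewrite <- pochhammer_shift; field; repeat split; assumption.
Qed.

(** The coefficient of [w ^ k] on the left is [(s + k) v k], which is [s] times
    the coefficient of the original function. *)
Lemma pFq_raise_euler (a c : list C) (s w : C) :
  (forall cj, In cj c -> ~ positive_integer (1 - cj)%C) ->
  s <> RtoC 0 -> ~ positive_integer (- s)%C ->
  let v := hyp_coef (a ++ [s]) (c ++ [1 + s]%C) in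
  in_Cdisk v w ->
  (s * CPSeries v w + w * CPSeries (CPS_derive v) w = s * pFq a c w)%C.
Proof.
intros Hc Hs0 Hs v Hw.
assert (E : pFq a c w
  = (/ s * (s * CPSeries v w + w * CPSeries (CPS_derive v) w))%C).
{ rewrite pFq_CPSeries; apply CSeries_unique.
  eapply is_Cseries_ext;
    [|exact (is_Cseries_scal (/ s) _ _ (is_Cseries_plus _ _ _ _
        (is_Cseries_scal s _ _ (is_CPSeries v w Hw)) (is_CPSeries_euler v w Hw)))].
  intros k; cbv beta.
  replace (hyp_coef a c k) with (/ s * (s * hyp_coef a c k))%C by (field; exact Hs0).
  rewrite <- (hyp_coef_raise a c s k Hc Hs); fold v; ring. }
rewrite E; field; exact Hs0.
Qed.

(** * The primitive in the variable [log x] *)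

Lemma is_Cderive_cpow (l s : C) : is_Cderive (fun l => cpow l s) l (s * cpow l s)%C.
Proof.
exact (is_Cderive_comp Cexp (fun l => s * l)%C l _ _
         (is_Cderive_Cexp _) (is_Cderive_linear s l)).
Qed.

(** The factor [Cexp l] is [dx / dl] for [x = Cexp l]; the other factor is the
    integrand. *)
Lemma is_Cderive_primitive_log (a c : list C) (gamma alpha beta const l : C) :
  (length a <= length c + 1)%nat ->
  (forall cj, In cj c -> ~ positive_integer (1 - cj)%C) ->
  alpha <> (- (1))%C -> beta <> RtoC 0 ->
  ~ positive_integer (- ((alpha + 1) / beta))%C ->
  (length a = (length c + 1)%nat -> (Cmod (gamma * cpow l beta)%C < 1)%R) ->
  is_Cderive (fun l =>
      cpow l (alpha + 1) / (alpha + 1)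
      * pFq (a ++ [(alpha + 1) / beta]) (c ++ [1 + (alpha + 1) / beta])
          (gamma * cpow l beta) + const)%C l
    (Cexp l * (cpow l alpha * pFq a c (gamma * cpow l beta)))%C.
Proof.
intros Hlen Hc Halpha Hbeta Hs Hx.
set (s := ((alpha + 1) / beta)%C) in *.
assert (Ha1 : (alpha + 1)%C <> RtoC 0).
{ intros H; apply Halpha; replace alpha with ((alpha + 1) - 1)%C by ring.
  rewrite H; ring. }
assert (Hsb : (s * beta)%C = (alpha + 1)%C) by (unfold s; field; exact Hbeta).
assert (Hs0 : s <> RtoC 0).
{ intros H; apply Ha1; rewrite <- Hsb, H; ring. }
set (v := hyp_coef (a ++ [s]) (c ++ [1 + s]%C)).
set (w := (gamma * cpow l beta)%C) in *.
assert (Hw : in_Cdisk v w).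
{ apply in_Cdisk_hyp_coef.
  - rewrite !length_app; simpl; lia.
  - intros cj Hin; apply in_app_or in Hin; destruct Hin as [Hin|[<-|[]]].
    + now apply Hc.
    + now replace (1 - (1 + s))%C with (- s)%C by ring.
  - rewrite !length_app; simpl; intros H; apply Hx; lia. }
assert (Heuler := pFq_raise_euler a c s w Hc Hs0 Hs Hw).
cbv zeta in Heuler; fold v in Heuler.
apply (is_derive_ext (K := C_AbsRing) (V := C_NormedModule)
  (fun l => (cpow l (alpha + 1) * / (alpha + 1))
            * CPSeries v (gamma * cpow l beta) + const)%C).
{ intros t; rewrite pFq_CPSeries; reflexivity. }
assert (D := is_Cderive_plus _ _ _ _ _
  (is_Cderive_mult _ _ _ _ _
    (is_Cderive_mult _ _ _ _ _ (is_Cderive_cpow l (alpha + 1))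
       (is_Cderive_const (/ (alpha + 1)) l))
    (is_Cderive_comp _ (fun l => gamma * cpow l beta)%C l _ _
       (is_Cderive_CPSeries v w Hw)
       (is_Cderive_mult _ _ _ _ _ (is_Cderive_const gamma l)
          (is_Cderive_cpow l beta))))
  (is_Cderive_const const l)).
cbv beta in D; fold w in D.
match type of D with is_derive _ _ ?d =>
  replace (Cexp l * (cpow l alpha * pFq a c w))%C with d; [exact D|] end.
assert (Hpow : cpow l (alpha + 1) = (Cexp l * cpow l alpha)%C).
{ unfold cpow; rewrite <- Cexp_plus; f_equal; ring. }
replace (pFq a c w) with (/ s * (s * pFq a c w))%C by (field; exact Hs0).
rewrite <- Heuler, Hpow.
transitivity (Cexp l * cpow l alpha * (CPSeries v w
   + beta / (alpha + 1) * w * CPSeries (CPS_derive v) w))%C.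
- unfold w; field; exact Ha1.
- rewrite <- Hsb; field; split; assumption.
Qed.

(** * Back to the variable [x] *)

(** The embedding [i] gives one argument for a complex and for a real variable:
    continuity of [L] carries [Cderive_relative] for [Cexp] back to [T], where
    the increments of [Cexp] become those of [i]. *)
Lemma log_branch_increment {T : UniformSpace} (i : T -> C) (D : T -> Prop)
    (L : T -> C) (H : C -> C) (x : T) (d : C) :
  open D -> log_branch i D L -> D x ->
  is_Cderive H (L x) (Cexp (L x) * d)%C ->
  forall eps : posreal, locally x (fun y =>
    Cmod (H (L y) - H (L x) - (i y - i x) * d) <= eps * Cmod (i y - i x))%R.
Proof.
intros HD HL Hx HH eps.
destruct (HL x Hx) as [Hcont Hexp].
assert (Hrel := Cderive_relative Cexp H (L x) _ _ (is_Cderive_Cexp (L x)) HH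
                  (Cexp_neq_0 (L x)) eps).
generalize (filter_and _ _ (HD x Hx) (Hcont _ Hrel)).
apply filter_imp; intros y [Hy Hinc].
replace (Cexp (L x) * d / Cexp (L x))%C with d in Hinc
  by (field; apply Cexp_neq_0).
now rewrite (proj2 (HL y Hy)), Hexp in Hinc.
Qed.

Lemma antiderivative_log_branch_C (D : C -> Prop) (L H g : C -> C) :
  open (T := C_UniformSpace) D ->
  log_branch (T := C_UniformSpace) (fun x => x) D L ->
  (forall x, D x -> is_Cderive H (L x) (Cexp (L x) * g x)%C) ->
  antiderivative (K := C_AbsRing) (V := C_NormedModule) D g (fun x => H (L x)).
Proof.
intros HD HL HH x Hx; apply is_Cderive_eps; intros eps.
destruct (locally_norm_le_locally (V := C_NormedModule) x _
  (log_branch_increment (fun x => x) D L H x (g x) HD HL Hx (HH x Hx) eps))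
  as [delta Hdelta].
exists delta; intros y Hy; exact (Hdelta y Hy).
Qed.

Lemma antiderivative_log_branch_R (D : R -> Prop) (L : R -> C) (H : C -> C)
    (g : R -> C) :
  open D -> log_branch (T := R_UniformSpace) RtoC D L ->
  (forall x, D x -> is_Cderive H (L x) (Cexp (L x) * g x)%C) ->
  antiderivative (K := R_AbsRing) (V := C_R_NormedModule) D g (fun x => H (L x)).
Proof.
intros HD HL HH x Hx; split.
- exact (is_linear_scal_l (K := R_AbsRing) (V := C_R_NormedModule) (g x)).
- intros x' Hx' eps.
  rewrite <- (is_filter_lim_locally_unique (V := R_NormedModule) _ _ Hx').
  generalize (log_branch_increment RtoC D L H x (g x) HD HL Hx (HH x Hx) eps).
  apply filter_imp; intros y Hy.
  rewrite <- RtoC_minus, Cmod_R in Hy.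
  rewrite scal_R_Cmult.
  eapply Rle_trans; [|exact Hy].
  right; symmetry; exact (Cmod_norm _).
Qed.

(** * The integral formula *)

Theorem corollary1 :
  forall (p q : nat) (a c : list C) (gamma alpha beta : C),
  length a = p ->
  length c = q ->
  (p <= q + 1)%nat ->
  (forall cj : C, In cj c -> ~ positive_integer (1 - cj)%C) ->
  alpha <> (- (1))%C ->
  beta <> RtoC 0 ->
  ~ positive_integer (- ((alpha + 1) / beta))%C ->
  (forall (U : C -> Prop) (L : C -> C) (const : C),
     open (T := C_UniformSpace) U ->
     connected_subset (T := C_UniformSpace) U ->
     (forall x : C, U x -> x <> RtoC 0) ->
     log_branch (T := C_UniformSpace) (fun x => x) U L ->
     (p = (q + 1)%nat ->
        forall x : C, U x -> (Cmod (gamma * cpow (L x) beta)%C < 1)%R) ->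
     antiderivative (K := C_AbsRing) (V := C_NormedModule) U
       (fun x : C =>
          cpow (L x) alpha * pFq a c (gamma * cpow (L x) beta))%C
       (fun x : C =>
          cpow (L x) (alpha + 1) / (alpha + 1)
          * pFq (a ++ [(alpha + 1) / beta]) (c ++ [1 + (alpha + 1) / beta])
              (gamma * cpow (L x) beta)
          + const)%C)
  /\
  (forall (lo hi : Rbar) (L : R -> C) (const : C),
     let I := fun x : R => Rbar_lt lo x /\ Rbar_lt x hi in
     Rbar_le 0 lo ->
     log_branch (T := R_UniformSpace) RtoC I L ->
     (p = (q + 1)%nat ->
        forall x : R, I x -> (Cmod (gamma * cpow (L x) beta)%C < 1)%R) ->
     antiderivative (K := R_AbsRing) (V := C_R_NormedModule) I
       (fun x : R =>
          cpow (L x) alpha * pFq a c (gamma * cpow (L x) beta))%C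
       (fun x : R =>
          cpow (L x) (alpha + 1) / (alpha + 1)
          * pFq (a ++ [(alpha + 1) / beta]) (c ++ [1 + (alpha + 1) / beta])
              (gamma * cpow (L x) beta)
          + const)%C).
Proof.
intros p q a c gamma alpha beta Hp Hq Hpq Hc Halpha Hbeta Hs; subst p q.
split.
- intros U L const HU _ _ HL Hdisk.
  refine (antiderivative_log_branch_C U L (fun l =>
    cpow l (alpha + 1) / (alpha + 1)
    * pFq (a ++ [(alpha + 1) / beta]) (c ++ [1 + (alpha + 1) / beta])
        (gamma * cpow l beta) + const)%C _ HU HL _).
  intros x Hx; apply is_Cderive_primitive_log; auto.
- intros lo hi L const I _ HL Hdisk.
  refine (antiderivative_log_branch_R I L (fun l =>
    cpow l (alpha + 1) / (alpha + 1)
    * pFq (a ++ [(alpha + 1) / beta]) (c ++ [1 + (alpha + 1) / beta])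
        (gamma * cpow l beta) + const)%C _ _ HL _).
  + apply open_and; [apply open_Rbar_gt | apply open_Rbar_lt].
  + intros x Hx; apply is_Cderive_primitive_log; auto.
Qed.
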